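(* Let $R$ be a ring. If $\{\mathscr{P}_\sigma\mid \sigma \text{ is a } t\text{-radical on } R\text{-Mod}\}=R\text{-conat}$, then $R$ is a left MAX ring.
   Context: $R$ is an associative ring with identity; modules are left $R$-modules. A preradical on $R\text{-Mod}$ is a functor $\sigma:R\text{-Mod}\to R\text{-Mod}$ with $\sigma(M)\le M$ for all $M$ and $f(\sigma(M))\le\sigma(N)$ for every homomorphism $f:M\to N$ ($\sigma(f)$ being the restriction of $f$). $\sigma$ is a $t$-radical if $\sigma(M)=\sigma(R)M$ for every module $M$. $\mathbb{T}_\sigma=\{M\mid\sigma(M)=M\}$. $\mathscr{P}_\sigma$ is the class of all modules $M$ having no nonzero quotient in $\mathbb{T}_\sigma$ (the zero module is included). For a class $\mathscr{D}$ of modules closed under quotients, $\mathscr{D}^{\perp_\twoheadrightarrow}$ is the class of all modules having no nonzero quotient in $\mathscr{D}$. $R\text{-conat}$ is the collection of conatural classes, i.e. classes of the form $\mathscr{D}^{\perp_\twoheadrightarrow}$ with $\mathscr{D}$ a class of modules closed under quotients. $R$ is a left MAX ring if every nonzero left $R$-module has a maximal submodule. *)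

(* Defs.v *)
From mathcomp Require Import all_boot all_order all_algebra.

Set Implicit Arguments.
Unset Strict Implicit.
Unset Printing Implicit Defensive.

Import GRing.Theory.

Local Open Scope ring_scope.

(* [R : pzRingType] is an arbitrary associative ring with identity, the zero
   ring included.  Submodules and classes of modules are Prop-valued predicates,
   so that membership is not required to be decidable. *)

Definition nonzero_module (R : pzRingType) (M : lmodType R) : Prop :=
  exists x : M, x <> 0.

Definition is_submodule (R : pzRingType) (M : lmodType R) (N : M -> Prop) : Prop :=
  N 0 /\ forall (a : R) (x y : M), N x -> N y -> N (a *: x + y).

Definition is_maximal_submodule (R : pzRingType) (M : lmodType R)
    (N : M -> Prop) : Prop :=
  [/\ is_submodule N,
      exists x : M, ~ N x
    & forall L : M -> Prop, is_submodule L -> (forall x, N x -> L x) ->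
        (forall x, L x -> N x) \/ (forall x, L x)].

Definition left_max_ring (R : pzRingType) : Prop :=
  forall M : lmodType R, nonzero_module M ->
    exists N : M -> Prop, is_maximal_submodule N.

(* The action of the functor on morphisms is restriction, hence it carries no
   data beyond [preradical_hom], and the functor laws hold automatically. *)
Record preradical (R : pzRingType) := Preradical {
  preradical_at :> forall M : lmodType R, M -> Prop;
  preradical_submodule : forall M : lmodType R, is_submodule (@preradical_at M);
  preradical_hom : forall (M N : lmodType R) (f : {linear M -> N}) (x : M),
    preradical_at x -> preradical_at (f x)
}.

(* The product I M: finite sums of products a *: m with a in I and m in M. *)
Definition ideal_mul (R : pzRingType) (I : R -> Prop) (M : lmodType R)
    (x : M) : Prop :=
  exists (n : nat) (a : 'I_n -> R) (m : 'I_n -> M),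
    (forall i, I (a i)) /\ x = \sum_(i < n) a i *: m i.

(* [R^o] is R regarded as a left module over itself. *)
Definition t_radical (R : pzRingType) (sigma : preradical R) : Prop :=
  forall (M : lmodType R) (x : M),
    sigma M x <-> @ideal_mul R (sigma R^o) M x.

Definition module_class (R : pzRingType) := lmodType R -> Prop.

(* Quotients of M are represented, up to isomorphism, by the codomains of the
   surjective homomorphisms out of M; in particular, a class closed under
   quotients is closed under isomorphism. *)
Definition closed_under_quotients (R : pzRingType) (D : module_class R) : Prop :=
  forall (M N : lmodType R) (f : {linear M -> N}),
    (forall y, exists x, f x = y) -> D M -> D N.

Definition no_nonzero_quotient_in (R : pzRingType) (D : module_class R) :
    module_class R :=
  fun M => forall (N : lmodType R) (f : {linear M -> N}),
    (forall y, exists x, f x = y) -> D N -> ~ nonzero_module N.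

Definition T_class (R : pzRingType) (sigma : preradical R) : module_class R :=
  fun M => forall x : M, sigma M x.

Definition P_class (R : pzRingType) (sigma : preradical R) : module_class R :=
  no_nonzero_quotient_in (T_class sigma).

Definition same_class (R : pzRingType) (C D : module_class R) : Prop :=
  forall M : lmodType R, C M <-> D M.

Definition conatural_class (R : pzRingType) (C : module_class R) : Prop :=
  exists D : module_class R,
    closed_under_quotients D /\ same_class C (no_nonzero_quotient_in D).

Definition t_radical_P_class (R : pzRingType) (C : module_class R) : Prop :=
  exists sigma : preradical R, t_radical sigma /\ same_class C (P_class sigma).

(* Main.v *)
Require Import Defs.
From mathcomp Require Import all_boot all_order all_algebra.
From HB Require Import structures.
From mathcomp Require Import boolp classical_sets.

(** Apply the hypothesis to the class of simple modules, with the zero module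
    added so that it is closed under quotients.  The modules with no nonzero
    quotient in that class are those with no maximal submodule, so for some
    t-radical sigma they are exactly the modules with no nonzero quotient in
    T_sigma.

    The ideal I = sigma(R) must then be all of R.  Otherwise I lies in a maximal
    left ideal K, and R/K is simple, hence has a nonzero quotient N in T_sigma,
    so that N = I N.  But I is closed under right multiplication, so I R is
    contained in K, and I kills R/K together with its quotient N: a
    contradiction.

    Hence I = R, and sigma(M) = R M = M for every module M, which says that every
    module lies in T_sigma.  A module without maximal submodules has no nonzero
    quotient in T_sigma, and as it is such a quotient of itself, it is zero.

    The existence of K is [submodule_maximal_avoiding] (Zorn), the simplicity of
    R/K and the passage from simple quotients to maximal submodules are
    [quotient_by_maximal_simple] and [kernel_maximal], and the argument that
    I kills every quotient of R/K is [P_class_of_vanishing_on_ideal]. *)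

Set Implicit Arguments.
Unset Strict Implicit.
Unset Printing Implicit Defensive.

Import GRing.Theory.

Local Open Scope ring_scope.
Local Open Scope quotient_scope.

Section Submodules.

Variables (R : pzRingType) (M : lmodType R).
Implicit Type N : M -> Prop.

Lemma submoduleD N x y : is_submodule N -> N x -> N y -> N (x + y).
Proof. by case=> _ hN hx hy; rewrite -[x]scale1r; exact: hN. Qed.

Lemma submoduleZ N (a : R) x : is_submodule N -> N x -> N (a *: x).
Proof. by case=> h0 hN hx; rewrite -[_ *: _]addr0; exact: hN. Qed.

Lemma submoduleB N x y : is_submodule N -> N x -> N y -> N (x - y).
Proof.
by move=> hN hx hy; rewrite -scaleN1r; apply: submoduleD => //; exact: submoduleZ.
Qed.

(** Zorn's lemma. Having to avoid a fixed element is a condition that unions of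
    chains inherit; for M = R and g = 1 it means being a proper left ideal. *)
Lemma submodule_maximal_avoiding N (g : M) : is_submodule N -> ~ N g ->
  exists K : M -> Prop,
    [/\ is_submodule K, (forall x, N x -> K x), ~ K g
      & forall L : M -> Prop, is_submodule L -> (forall x, K x -> L x) ->
          (forall x, L x -> K x) \/ L g].
Proof.
move=> hN Ng.
(* The empty set is admitted because it is the union of the empty chain. *)
pose P (A : set M) := (exists x, A x) ->
  [/\ is_submodule A, (forall x, N x -> A x) & ~ A g].
have chainP (F : set (set M)) : (F `<=` P)%classic -> total_on F subset ->
    P (\bigcup_(X in F) X)%classic.
  move=> FP Ftot [z [Z FZ Zz]]; split.
  - split.
      by exists Z => //; have [[]] := FP Z FZ (ex_intro _ z Zz).
    move=> a x y [X FX Xx] [Y FY Yy].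
    have [XY|YX] := Ftot X Y FX FY.
      exists Y => //; have [[_ hY] _ _] := FP Y FY (ex_intro _ y Yy).
      by apply: hY => //; exact: XY.
    exists X => //; have [[_ hX] _ _] := FP X FX (ex_intro _ x Xx).
    by apply: hX => //; exact: YX.
  - move=> x Nx; exists Z => //.
    by have [_ NZ _] := FP Z FZ (ex_intro _ z Zz); exact: NZ.
  - move=> [X FX Xg].
    by have [_ _] := FP X FX (ex_intro _ g Xg); exact.
have [K [PK maxK]] := Zorn_bigcup chainP.
have Kne : exists x, K x.
  apply: contrapT => Ke; apply: (maxK N); last by [].
  split=> [x Kx|NK]; first by case: Ke; exists x.
  by apply: Ke; exists 0; apply: NK; case: hN.
have [hK NK Kg] := PK Kne.
exists K; split=> // L hL KL.
have [Lg|Lg] := EM (L g); [by right|left].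
apply: contrapT => LK; apply: (maxK L); first by split.
by move=> _; split=> // x Nx; exact/KL/NK.
Qed.

Variable N : M -> Prop.
Hypothesis hN : is_submodule N.

Let memN : {pred M} := fun x => `[< N x >].

Let memN_zmod_closed : zmod_closed memN.
Proof.
split; first by apply/asboolP; case: hN.
by move=> x y /asboolP hx /asboolP hy; apply/asboolP; exact: submoduleB.
Qed.

HB.instance Definition _ := GRing.isZmodClosed.Build M memN memN_zmod_closed.

Local Notation Q := (Quotient.quot memN).

Let pi_eq (x y : M) : N (x - y) <-> \pi_Q x = \pi_Q y.
Proof.
split=> [/asboolP h|h]; first by apply/eqP; rewrite -Quotient.idealrBE.
by apply/asboolP; move/eqP: h; rewrite -Quotient.idealrBE.
Qed.

Let scaleq (a : R) (x : Q) : Q := \pi_Q (a *: repr x).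

Let pi_scale a x : scaleq a (\pi_Q x) = \pi_Q (a *: x).
Proof.
by apply/pi_eq; rewrite -scalerBr; apply: submoduleZ => //; apply/pi_eq; rewrite reprK.
Qed.

Let scaleqA a b v : scaleq a (scaleq b v) = scaleq (a * b) v.
Proof. by rewrite -[v]reprK (pi_scale b) (pi_scale a) pi_scale scalerA. Qed.

Let scale1q : left_id 1 scaleq.
Proof. by move=> v; rewrite -[v]reprK pi_scale scale1r. Qed.

Let scaleqDr : right_distributive scaleq +%R.
Proof.
move=> a u v; rewrite -[u]reprK -[v]reprK.
by rewrite -raddfD !(pi_scale a) -raddfD scalerDr.
Qed.

Let scaleqDl v : {morph scaleq^~ v : a b / a + b}.
Proof. by move=> a b; rewrite -[v]reprK !pi_scale scalerDl raddfD. Qed.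

(** Excluded middle makes membership in N boolean, so that [Quotient.quot] gives
    M/N as an additive group; the scalar action is computed on representatives. *)
Lemma quotient_module_exists :
  exists (S : lmodType R) (p : {linear M -> S}),
    (forall y, exists x, p x = y) /\ (forall x, p x = 0 <-> N x).
Proof.
pose lm := GRing.Zmodule_isLmodule.Build R Q scaleqA scale1q scaleqDr scaleqDl.
pose S : lmodType R := HB.pack Q lm.
have pi_linear : linear (\pi_Q : M -> S).
  by move=> a x y; rewrite raddfD; congr (_ + _); exact/esym/pi_scale.
pose p : {linear M -> S} := HB.pack (\pi_Q : M -> S)
  (GRing.isLinear.Build R M S _ (\pi_Q : M -> S) pi_linear).
exists S, p; split=> [y|x]; first by exists (repr y); exact: reprK.
rewrite -(linear0 p) -{2}[x]subr0.
exact: iff_sym (pi_eq _ _).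
Qed.

End Submodules.

(** A module whose only submodules are 0 and itself. Zero is included, so that
    the class is closed under quotients. *)
Definition simple_or_zero (R : pzRingType) : module_class R :=
  fun M => forall L : M -> Prop, is_submodule L ->
    (forall x, L x -> x = 0) \/ (forall x, L x).

Section Quotients.

Variables (R : pzRingType) (M S : lmodType R) (f : {linear M -> S}).
Hypothesis f_surj : forall y, exists x, f x = y.

Lemma preimage_submodule (L : S -> Prop) :
  is_submodule L -> is_submodule (fun x => L (f x)).
Proof.
move=> [L0 hL]; split; first by rewrite linear0.
by move=> a x y Lx Ly; rewrite linearP; exact: hL.
Qed.

Lemma image_submodule (L : M -> Prop) :
  is_submodule L -> is_submodule (fun y => exists2 x, L x & f x = y).
Proof.
move=> [L0 hL]; split; first by exists 0; rewrite ?linear0.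
move=> a _ _ [x Lx <-] [y Ly <-]; exists (a *: x + y); first exact: hL.
by rewrite linearP.
Qed.

Lemma quotient_by_maximal_simple (K : M -> Prop) :
  is_maximal_submodule K -> (forall x, f x = 0 <-> K x) ->
  nonzero_module S /\ simple_or_zero S.
Proof.
move=> [hK [g Kg] maxK] kerf; split; first by exists (f g) => /kerf.
move=> L hL; have [L0 _] := hL.
case: (maxK (fun x => L (f x))).
- exact: preimage_submodule.
- by move=> x /kerf ->.
- by move=> LK; left=> y; have [x <-] := f_surj y => Ly; apply/kerf/LK.
- by move=> LT; right=> y; have [x <-] := f_surj y.
Qed.

Lemma kernel_maximal : nonzero_module S -> simple_or_zero S ->
  is_maximal_submodule (fun x => f x = 0).
Proof.
move=> [y yN0] simS; split.
- split=> [|a x z fx fz]; first exact: linear0.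
  by rewrite linearP fx fz scaler0 addr0.
- by have [x fx] := f_surj y; exists x; rewrite fx.
move=> L hL kerL.
case: (simS _ (image_submodule hL)) => [L0|LT].
  by left=> x Lx; apply: L0; exists x.
(* An element of f(L) lifts to L, and the choice of lift is immaterial because
   L contains the kernel. *)
right=> x; have [z Lz fz] := LT (f x).
rewrite -[x](subrK z); apply: submoduleD => //.
by apply: kerL; rewrite linearB fz subrr.
Qed.

End Quotients.

Lemma simple_or_zero_quotients (R : pzRingType) :
  closed_under_quotients (@simple_or_zero R).
Proof.
move=> M S f f_surj simM L hL; have [L0 _] := hL.
case: (simM _ (preimage_submodule f hL)) => [LK|LT].
  by left=> y; have [x <-] := f_surj y => /LK ->; rewrite linear0.
by right=> y; have [x <-] := f_surj y.
Qed.

(** The ideal I = sigma(R) sends every element r of R into I, because right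
    multiplication by r is an endomorphism of the left module R. If p vanishes
    on I, then I acts as zero on the image S of p and on every quotient N of S,
    so N = I N is possible only for N = 0. *)
Lemma P_class_of_vanishing_on_ideal (R : pzRingType) (sigma : preradical R)
    (S : lmodType R) (p : {linear R^o -> S}) :
  t_radical sigma -> (forall y, exists x, p x = y) ->
  (forall a, sigma R^o a -> p a = 0) -> P_class sigma S.
Proof.
move=> tsigma p_surj pI N f f_surj TN [n]; apply.
have /tsigma [k [a [m [Ia ->]]]] := TN n.
apply: big1 => i _.
have [s <-] := f_surj (m i); have [r <-] := p_surj s.
rewrite -!linearZ pI ?linear0 //.
pose rmul : {linear R^o -> R^o} := HB.pack (fun x : R^o => x *: r)
  (GRing.isLinear.Build R R^o R^o _ (fun x : R^o => x *: r)
     (fun b x y => etrans (scalerDl r (b *: x) y)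
        (congr1 (fun t => t + y *: r) (esym (scalerA b x r))))).
exact: (preradical_hom rmul (Ia i)).
Qed.

Theorem theorem4p21 (R : pzRingType)
    (hconat : forall C : module_class R, t_radical_P_class C <-> conatural_class C) :
  left_max_ring R.
Proof.
have [|sigma [tsigma sameP]] := (hconat (no_nonzero_quotient_in (@simple_or_zero R))).2.
  by exists (@simple_or_zero R); split=> //; exact: simple_or_zero_quotients.
have I1 : sigma R^o 1.
  apply: contrapT => NI1.
  have [K [hK IK K1 maxK]] :=
    submodule_maximal_avoiding (preradical_submodule sigma R^o) NI1.
  have maxK' : is_maximal_submodule K.
    split=> //; first by exists 1.
    move=> L hL KL; have [LK|L1] := maxK L hL KL; first by left.
    by right=> x; rewrite -[x]mulr1; apply: (submoduleZ x hL L1).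
  have [S [p [p_surj kerp]]] := quotient_module_exists hK.
  have [Sne simS] := quotient_by_maximal_simple p_surj maxK' kerp.
  have /sameP perpS : P_class sigma S.
    by apply: (P_class_of_vanishing_on_ideal tsigma p_surj) => a Ia; apply/kerp/IK.
  by apply: (perpS S idfun) => // y; exists y.
move=> M Mne; apply: contrapT => noMax.
have /sameP PM : no_nonzero_quotient_in (@simple_or_zero R) M.
  move=> S f f_surj simS Sne; apply: noMax.
  by exists (fun x => f x = 0); exact: kernel_maximal.
apply: (PM M idfun _ _ Mne) => [y|x]; first by exists y.
by apply/tsigma; exists 1, (fun=> 1), (fun=> x); rewrite big_ord1 scale1r.
Qed.
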